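(* For every $n\in\mathbb{N}$ and every $\sigma\in S_n$, $$P_n^{\text{park}}(\sigma)=\frac{L_n(\sigma)}{(n+1)^{n-1}}.$$
   Context: $[n]=\{1,\dots,n\}$ and $S_n$ is the set of permutations $\sigma=\sigma_1\cdots\sigma_n$ of $[n]$. Parking: cars $1,\dots,n$ arrive in this order on a one-way street with spaces $1,\dots,n$; given a sequence $\pi=(\pi_1,\dots,\pi_n)\in[n]^n$ of preferred spaces, car $i$ parks in space $\pi_i$ if it is free, and otherwise in the first free space with number greater than $\pi_i$, if one exists (if none exists the car exits the street). $\pi$ is a parking function on $[n]$ if all $n$ cars are able to park; $\mathcal{P}_n$ is the set of parking functions on $[n]$. The map $T_n:\mathcal{P}_n\to S_n$ is $T_n(\pi)=\sigma$, where $\sigma_j$ is the number of the car that parked in space $j$, $j\in[n]$. The probability measure $P_n^{\text{park}}$ on $S_n$ is $P_n^{\text{park}}(\sigma)=|T_n^{-1}(\{\sigma\})|/|\mathcal{P}_n|$. For $1\le i\le n$ and $\sigma\in S_n$, $l_{n,i}(\sigma)=\max\{l\in[i]:\ \sigma_i=\max(\sigma_i,\sigma_{i-1},\dots,\sigma_{i-l+1})\}$, and $L_n(\sigma)=\prod_{i=1}^n l_{n,i}(\sigma)$. *)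

(* Defs.v *)
From mathcomp Require Import all_boot all_order all_fingroup all_algebra.

Set Implicit Arguments.
Unset Strict Implicit.
Unset Printing Implicit Defensive.

Import GRing.Theory.

(* Cars, spaces and positions 1, ..., n are represented by 0, ..., n-1 : 'I_n. *)

Section Parking.
Variable n : nat.

Definition street := {ffun 'I_n -> option 'I_n}.

Definition empty_street : street := [ffun=> None].

(* [enum 'I_n] is increasing, so [ohead] yields the least free space beyond
   the preferred one, if any. *)
Definition parking_space (st : street) (p : 'I_n) : option 'I_n :=
  if st p == None then Some p
  else ohead [seq s : 'I_n <- enum 'I_n | (p < s) && (st s == None)].

Definition park_car (pi : {ffun 'I_n -> 'I_n}) (st : street) (i : 'I_n)
    : street :=
  if parking_space st (pi i) is Some s
  then [ffun t => if t == s then Some i else st t]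
  else st.

Definition final_street (pi : {ffun 'I_n -> 'I_n}) : street :=
  foldl (park_car pi) empty_street (enum 'I_n).

Definition is_parking_function (pi : {ffun 'I_n -> 'I_n}) : bool :=
  [forall i, exists s, final_street pi s == Some i].

Definition parking_function :=
  {p : {ffun 'I_n -> 'I_n} | is_parking_function p}.

(* The default value is never used for a parking function: see [outcomeE]. *)
Definition car_in (pi : {ffun 'I_n -> 'I_n}) (s : 'I_n) : 'I_n :=
  odflt s (final_street pi s).

Lemma parking_function_full (pi : parking_function) :
  exists2 g : 'I_n -> 'I_n, bijective g
    & forall i, final_street (val pi) (g i) = Some i.
Proof.
have ex i : exists s, final_street (val pi) s == Some i.
  by apply/existsP; move/forallP: (valP pi).
pose g i := xchoose (ex i).
have gP i : final_street (val pi) (g i) = Some i by apply/eqP/(xchooseP (ex i)).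
exists g => //; apply: injF_bij => i j eq_g.
by have := gP i; rewrite eq_g gP => -[].
Qed.

Lemma car_in_inj (pi : parking_function) : injective (car_in (val pi)).
Proof.
have [g [h hK gK] gP] := parking_function_full pi.
apply: (can_inj (g := g)) => s.
by rewrite /car_in -{2}(gK s) gP /= gK.
Qed.

Definition outcome (pi : parking_function) : 'S_n := perm (@car_in_inj pi).

Lemma outcomeE (pi : parking_function) (s : 'I_n) :
  final_street (val pi) s = Some (outcome pi s).
Proof.
have [g [h hK gK] gP] := parking_function_full pi.
by rewrite permE /car_in -(gK s) gP.
Qed.

Definition park_prob (sigma : 'S_n) : rat :=
  (#|outcome @^-1: [set sigma]|%:R / #|{: parking_function}|%:R)%R.

(* With positions counted from 0, [l] ranges over 1, ..., i + 1 and the window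
   of length [l] ending at position [i] is i + 1 - l, ..., i. *)
Definition run_length (sigma : 'S_n) (i : 'I_n) : nat :=
  \max_(1 <= l < i.+2
        | nat_of_ord (sigma i) == \max_(j < n | i.+1 - l <= j <= i) sigma j) l.

Definition run_length_prod (sigma : 'S_n) : nat :=
  \prod_(i < n) run_length sigma i.

End Parking.

(* Main.v *)
Require Import Defs.
From mathcomp Require Import all_boot all_order all_fingroup all_algebra.

Set Implicit Arguments.
Unset Strict Implicit.
Unset Printing Implicit Defensive.

(** Two independent counts give the formula.

    Numerator. Suppose that the outcome is [sigma], and let [s] be a space.
    When car [sigma s] arrives, the occupied spaces are exactly those [t] with
    [sigma t < sigma s], so the street which the car meets is determined by
    [sigma] alone. The car stops at [s] if and only if it prefers some [p <= s]
    such that [p, ..., s - 1] are all occupied, that is, such that [sigma s] is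
    the largest value of [sigma] on [p, ..., s] ([partial_parks]). Hence the
    constraints on the preferences of different cars are independent
    ([final_streetP]), and the fibre over [sigma] is a product. The admissible
    [p] correspond to the windows ending at [s] on which [sigma s] is maximal;
    these windows have lengths 1, ..., [run_length sigma s]
    ([card_admissible_pref]), so the fibre has [run_length_prod sigma] elements
    ([card_outcome_fibre]).

    Denominator. This is Pollak's argument. Add one more space, bend the street
    into a circle with [n.+1] spaces, and let the [n] cars have any preferences
    on the circle. All cars park, and exactly one space remains free. Rotating
    all preferences rotates the free space, so each space is left free by the
    same number of the [n.+1 ^ n] preference functions ([card_leaves_free]).
    If the added space stays free, then no car has preferred it or passed it,
    so the cars move as on the original street: the preference functions that
    leave it free are the parking functions ([is_parking_function_circle]).
    So there are [n.+1 ^ n / n.+1] of them ([card_parking_function]). *)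

(** * The street after each arrival *)

Section Stages.
Variable n : nat.
Implicit Types (st : street n) (pi : {ffun 'I_n -> 'I_n}) (p s t i j : 'I_n).

Variant parking_space_spec st p : option 'I_n -> Type :=
  | ParksAt s of st s = None & p <= s & (forall t, p <= t -> t < s -> st t) :
      parking_space_spec st p (Some s)
  | Exits of (forall t, p <= t -> st t) : parking_space_spec st p None.

(** The scanned list is increasing, so its first element is the least free
    space beyond the preferred one, and all spaces before it are occupied. *)
Lemma parking_spaceP st p : parking_space_spec st p (parking_space st p).
Proof.
rewrite /parking_space; case: eqP => [stp | /eqP stp].
  by apply: ParksAt => // t pt /(leq_ltn_trans pt); rewrite ltnn.
have occ_p t : p <= t -> ~~ (p < t) -> st t.
  move=> pt; rewrite -leqNgt => tp.
  have -> : t = p by apply/val_inj/anti_leq/andP.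
  by case: (st p) stp.
set a := fun t => (p < t) && (st t == None).
have sorted_free : sorted (relpre val ltn) (filter a (enum 'I_n)).
  apply: sorted_filter; first by move=> x y z; apply: ltn_trans.
  by rewrite -sorted_map val_enum_ord iota_ltn_sorted.
have mem_free t : (t \in filter a (enum 'I_n)) = a t.
  by rewrite mem_filter mem_enum andbT.
case: (filter a _) sorted_free mem_free => [|s r] /= => [_ | path_r] mem_free.
  apply: Exits => t pt; have [/negPf/= pt'|] := boolP (~~ (p < t)).
    by apply: occ_p; rewrite ?pt'.
  rewrite negbK => lt_pt; have := mem_free t.
  by rewrite /a lt_pt; case: (st t).
have : a s by rewrite -mem_free inE eqxx.
case/andP=> ps /eqP st_s; apply: ParksAt => //; first exact: ltnW.
move=> t pt ts; have [|] := boolP (~~ (p < t)); first exact: occ_p.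
rewrite negbK => lt_pt; have := mem_free t; rewrite /a lt_pt inE.
have /allP min_s : all (relpre val ltn s) r.
  by apply: order_path_min path_r => x y z; apply: ltn_trans.
case: (st t) => //=; case/orP=> [/eqP ts'|/min_s /=].
  by rewrite ts' ltnn in ts.
by rewrite ltnNge (ltnW ts).
Qed.

Lemma parking_space_first st p s :
    st s = None -> p <= s -> (forall t, p <= t -> t < s -> st t) ->
  parking_space st p = Some s.
Proof.
move=> st_s ps occ; case: parking_spaceP => [s' st_s' ps' occ'|/(_ s ps)].
  congr Some; apply/val_inj; case: (ltngtP s' s) => //.
    by move/(occ _ ps'); rewrite st_s'.
  by move/(occ' _ ps); rewrite st_s.
by rewrite st_s.
Qed.

(** The street met by car [k]; for [k = n] it is the final street. *)
Definition stage pi k : street n :=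
  foldl (park_car pi) (empty_street n) (take k (enum 'I_n)).

Lemma final_stage pi : final_street pi = stage pi n.
Proof. by rewrite /stage take_oversize ?size_enum_ord. Qed.

Lemma take_enum_ordS i :
  take i.+1 (enum 'I_n) = rcons (take i (enum 'I_n)) i.
Proof. by rewrite (take_nth i) ?size_enum_ord // nth_ord_enum. Qed.

Lemma stageS pi i : stage pi i.+1 = park_car pi (stage pi i) i.
Proof. by rewrite /stage take_enum_ordS foldl_rcons. Qed.

Lemma stage0 pi : stage pi 0 = empty_street n.
Proof. by rewrite /stage take0. Qed.

Lemma park_carE pi st i s j :
  park_car pi st i s = Some j <->
  st s = Some j \/ j = i /\ parking_space st (pi i) = Some s.
Proof.
rewrite /park_car; case: parking_spaceP => [s' st_s' _ _|_]; last first.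
  by split=> [|[|[]]]; [left|..].
rewrite ffunE; case: eqP => [->|ne].
  by rewrite st_s'; split=> [[<-]|[|[->]]] //; right.
by split=> [|[|[_ [/esym]]]] //; left.
Qed.

Lemma stage_keep pi k m s j :
  k <= m <= n -> stage pi k s = Some j -> stage pi m s = Some j.
Proof.
elim: m => [|m IHm]; first by rewrite leqn0 => /andP[/eqP->].
case/andP; rewrite leq_eqVlt => /predU1P[->//|km mn st_s].
by rewrite (stageS pi (Ordinal mn)); apply/park_carE; left;
   apply: IHm; rewrite // -ltnS km ltnW.
Qed.

Lemma stage_lt pi k s j : k <= n -> stage pi k s = Some j -> j < k.
Proof.
elim: k => [|k IHk] kn; first by rewrite stage0 ffunE.
rewrite (stageS pi (Ordinal kn)) => /park_carE[|[->//]].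
by move/IHk=> /(_ (ltnW kn))/ltnW.
Qed.

Lemma stage_restrict pi k m s j :
  k <= m <= n -> j < k -> stage pi m s = Some j -> stage pi k s = Some j.
Proof.
elim: m => [|m IHm]; first by rewrite leqn0 => /andP[/eqP->].
case/andP; rewrite leq_eqVlt => /predU1P[->//|km mn jk].
rewrite (stageS pi (Ordinal mn)) => /park_carE[|[eq_j _]].
  by apply: IHm; rewrite // -ltnS km ltnW.
by rewrite eq_j ltnNge -ltnS km in jk.
Qed.

Lemma stage_parks pi i s :
  stage pi i.+1 s = Some i <-> parking_space (stage pi i) (pi i) = Some s.
Proof.
rewrite stageS; split=> [/park_carE[|[]//]|eq_s]; last first.
  by apply/park_carE; right.
by move/stage_lt => /(_ (ltnW (ltn_ord i))); rewrite ltnn.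
Qed.

(** Cars never move once parked, and the arrival of car [i] adds no other car.
    So the final position of car [i] is decided at its own arrival. *)
Lemma final_parks pi i s :
  final_street pi s = Some i <-> parking_space (stage pi i) (pi i) = Some s.
Proof.
rewrite final_stage; split=> [fin_s|/stage_parks].
  by apply/stage_parks/(stage_restrict _ _ fin_s); rewrite ?ltn_ord /=.
by apply: stage_keep; rewrite ltn_ord /=.
Qed.

(** Parking functions are recognised arrival by arrival; this is the form that
    can be compared with the circular street. *)
Lemma is_parking_functionP pi :
  reflect (forall i, parking_space (stage pi i) (pi i))
          (is_parking_function pi).
Proof.
apply: (iffP forallP) => [park i | park i].
  by have /existsP[s /eqP/final_parks->] := park i.
apply/existsP; case E: (parking_space _ _) (park i) => [s|//] _.
by exists s; apply/eqP/final_parks.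
Qed.

(** * The fibres of the outcome map *)

Definition partial_street (sigma : 'S_n) k : street n :=
  [ffun s => if sigma s < k then Some (sigma s) else None].

(** The outcome determines every intermediate street. This makes the choices of
    the different cars independent. *)
Lemma stage_partial pi (sigma : 'S_n) k :
    (forall s, final_street pi s = Some (sigma s)) -> k <= n ->
  stage pi k = partial_street sigma k.
Proof.
move=> fin kn; apply/ffunP=> s; rewrite ffunE.
have fin_s := fin s; rewrite final_stage in fin_s.
case: ifP => [sk|sk].
  by apply: stage_restrict fin_s; rewrite ?kn /=.
case E: (stage pi k s) => [j|//].
have := stage_keep (m := n) _ E; rewrite fin_s kn leqnn => /(_ isT)[jE].
by rewrite jE (stage_lt kn E) in sk.
Qed.

Definition admissible_pref (sigma : 'S_n) s p : bool :=
  (p <= s) && [forall t : 'I_n, (p <= t <= s) ==> (sigma t <= sigma s)].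

(** In the street met by car [sigma s], a space [t] other than [s] is occupied
    if and only if [sigma t <= sigma s]: the admissible preferences of the car
    are those for which it finds [p, ..., s - 1] occupied and [s] free. *)
Lemma partial_parks (sigma : 'S_n) s p :
  (parking_space (partial_street sigma (sigma s)) p == Some s)
    = admissible_pref sigma s p.
Proof.
apply/eqP/andP => [|[ps /forallP dom]].
  case: parking_spaceP => // s' _ ps occ [eq_s]; subst s'; split=> //.
  apply/forallP=> t; apply/implyP=> /andP[pt].
  rewrite leq_eqVlt => /predU1P[/val_inj->//|/(occ _ pt)].
  by rewrite ffunE; case: ifP => // /ltnW.
apply: parking_space_first; rewrite // ?ffunE ?ltnn // => t pt ts.
rewrite ffunE ltn_neqAle (implyP (dom t)) ?pt ?(ltnW ts) // andbT.
rewrite (inj_eq val_inj) (inj_eq perm_inj) ifT //.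
by apply: contraL ts => /eqP->; rewrite ltnn.
Qed.

(** For the converse, the streets are determined one arrival after another: once
    car [k] meets the right street, [partial_parks] sends it to its space. *)
Lemma final_streetP pi (sigma : 'S_n) :
  (forall s, final_street pi s = Some (sigma s)) <->
  (forall s, admissible_pref sigma s (pi (sigma s))).
Proof.
split=> [fin s | good].
  rewrite -partial_parks -(stage_partial fin) ?(ltnW (ltn_ord _)) //.
  exact/eqP/final_parks.
have stE k : k <= n -> stage pi k = partial_street sigma k.
  elim: k => [_|k IHk kn].
    by rewrite stage0; apply/ffunP=> s; rewrite !ffunE.
  set i := Ordinal kn; rewrite (stageS pi i) /= IHk ?(ltnW kn) // /park_car.
  have iE : i = sigma (sigma^-1%g i) by rewrite permKV.
  have := good (sigma^-1%g i); rewrite -partial_parks -iE /= => /eqP->.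
  apply/ffunP=> t; rewrite !ffunE ltnS [in RHS]leq_eqVlt.
  case: eqP => [->|ne]; first by rewrite -iE eqxx.
  case: eqP => //= sk; case: ne; rewrite -[t](permK sigma); congr (_ _).
  exact: val_inj.
by move=> s; rewrite final_stage stE // ffunE ltn_ord.
Qed.

End Stages.

(** Both sides are the length of the initial segment of 1, ..., [m] on which
    [Q] holds. *)
Lemma max_initial_segment (Q : pred nat) m :
    (forall k l, 0 < k <= l -> Q l -> Q k) ->
  \max_(1 <= l < m.+1 | Q l) l = \sum_(1 <= l < m.+1 | Q l) 1.
Proof.
move=> downQ; elim: m => [|m IHm]; first by rewrite !big_geq.
rewrite big_mkcond [RHS]big_mkcond [LHS]big_nat_recr // [RHS]big_nat_recr //=.
rewrite -(big_mkcond Q (fun l => l)) -(big_mkcond Q (fun=> 1)) IHm.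
case: ifP => Qm; last by rewrite maxn0 addn0.
have -> : \sum_(1 <= l < m.+1 | Q l) 1 = m.
  rewrite big_nat_cond -[RHS]muln1 -[X in _ = X * _](subn1 m.+1).
  rewrite -sum_nat_const_nat [RHS]big_nat_cond; apply: eq_bigl => l; rewrite andbT.
  case: (boolP (1 <= l < m.+1)) => //= /andP[l_gt0 lm].
  by rewrite (downQ l m.+1) // l_gt0 ltnW.
by rewrite addn1; apply/maxn_idPr.
Qed.

Section Fibres.
Variables (n : nat) (sigma : 'S_n).

(** A preference [p] corresponds to the window [p, ..., s] of length
    [s.+1 - p]. The lengths of the windows on which [sigma s] is maximal are
    closed downwards, so their number is the greatest of them. *)
Lemma card_admissible_pref (s : 'I_n) :
  #|admissible_pref sigma s| = run_length sigma s.
Proof.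
pose W k := [forall t : 'I_n, (k <= t <= s) ==> (sigma t <= sigma s)].
have winE l : 0 < l ->
    (nat_of_ord (sigma s) == \max_(t < n | s.+1 - l <= t <= s) sigma t)
      = W (s.+1 - l).
  move=> l_gt0; apply/eqP/forallP => [eq_max t | dom].
    apply/implyP=> win_t; rewrite eq_max.
    exact: (leq_bigmax_cond (F := fun t => sigma t : nat)).
  apply/anti_leq/andP; split.
    apply: (leq_bigmax_cond (F := fun t => sigma t : nat)).
    by rewrite leqnn leq_subLR -addn1 addnC leq_add2r l_gt0.
  by apply/bigmax_leqP=> t /(implyP (dom t)).
have -> : run_length sigma s = \max_(1 <= l < s.+2 | W (s.+1 - l)) l.
  rewrite /run_length big_nat_cond [RHS]big_nat_cond; apply: eq_bigl => l.
  by case: (boolP (1 <= l < s.+2)) => //= /andP[/winE-> _].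
rewrite max_initial_segment => [|k l /andP[_ kl] /forallP dom]; last first.
  apply/forallP=> t; apply/implyP=> /andP[kt ts].
  by apply: (implyP (dom t)); rewrite ts (leq_trans _ kt) ?leq_sub2l.
(* After the reversal the sum over lengths is indexed by the left end of the
   window. *)
rewrite big_add1 big_nat_rev /= -sum1_card.
transitivity (\sum_(p < n | W p && (p < s.+1)) 1).
  by apply: eq_bigl => p; rewrite andbC.
rewrite -(big_mkord (fun p => W p && (p < s.+1)) (fun=> 1)) -big_nat_widen //.
rewrite big_nat_cond [RHS]big_nat_cond; apply: eq_bigl => p.
case: (boolP (0 <= p < s.+1)) => //= ps.
by rewrite add0n -subSn // subKn // ltnW.
Qed.

Lemma outcomeP (pi : parking_function n) :
  outcome pi = sigma <-> forall s, final_street (val pi) s = Some (sigma s).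
Proof.
split=> [<- s|fin]; first exact: outcomeE.
by apply/permP=> s; have := outcomeE pi s; rewrite fin => -[].
Qed.

Lemma card_outcome_fibre :
  #|@outcome n @^-1: [set sigma]| = run_length_prod sigma.
Proof.
pose F i : {pred 'I_n} := admissible_pref sigma (sigma^-1%g i).
rewrite -(card_imset _ val_inj).
have -> : #|val @: (@outcome n @^-1: [set sigma])| = #|family F|.
  apply: eq_card => pi; apply/imsetP/familyP => [[p] | good].
    rewrite !inE => /eqP/outcomeP/final_streetP good -> i.
    by have := good (sigma^-1%g i); rewrite permKV.
  have fin : forall s, final_street pi s = Some (sigma s).
    apply/final_streetP=> s; have := good (sigma s).
    by rewrite /F unfold_in permK.
  have park : is_parking_function pi.
    apply/forallP=> i; apply/existsP; exists (sigma^-1%g i).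
    by rewrite fin permKV.
  by exists (Sub pi park); rewrite ?inE //; apply/eqP/outcomeP.
rewrite card_family foldrE big_image /= (reindex_inj (@perm_inj _ sigma)) /=.
by apply: eq_bigr => s _; rewrite /F permK card_admissible_pref.
Qed.

End Fibres.

(** * The circular street *)

Section Circle.
Variable n : nat.
Implicit Types (O : {set 'I_n.+1}) (p q : 'I_n.+1) (f : {ffun 'I_n -> 'I_n.+1}).

(** Only occupied spaces are tracked. Rotation is [ordS] rather than addition
    in a ring of residues, so that the circle with one space ([n = 0]) is
    included. One full turn, [n.+1] trials, meets every space. *)
Definition circ_space O p : 'I_n.+1 :=
  iter (find (fun k => iter k (@ordS n.+1) p \notin O) (iota 0 n.+1))
       (@ordS n.+1) p.

Lemma val_iter_ordS k p : val (iter k (@ordS n.+1) p) = (p + k) %% n.+1.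
Proof.
elim: k => [|k IHk] /=; first by rewrite addn0 modn_small.
by rewrite IHk addnS -[in LHS]addn1 modnDml addn1.
Qed.

Lemma iter_ordS_reach p q : exists2 k, k < n.+1 & iter k (@ordS n.+1) p = q.
Proof.
exists ((q + (n.+1 - p)) %% n.+1); first by rewrite ltn_pmod.
apply: val_inj; rewrite val_iter_ordS modnDmr addnCA subnKC 1?ltnW //.
by rewrite modnDr modn_small.
Qed.

Lemma circ_space_free O p : O != setT -> circ_space O p \notin O.
Proof.
rewrite -subTset => /subsetPn[q _ qO].
have [k kn pkq] := iter_ordS_reach p q.
rewrite /circ_space; set a := fun k => _.
have has_a : has a (iota 0 n.+1).
  by apply/hasP; exists k; rewrite ?mem_iota // /a pkq.
have := nth_find 0 has_a; rewrite nth_iota //.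
by rewrite -[X in _ < X](size_iota 0) -has_find.
Qed.

(** When the search stops before it turns from [ord_max] to 0, the circle
    behaves as a street. *)
Lemma circ_space_first O p q :
    q \notin O -> p <= q -> (forall t : 'I_n.+1, p <= t -> t < q -> t \in O) ->
  circ_space O p = q.
Proof.
move=> qO pq occ; rewrite /circ_space; set a := fun k => _.
have valE k : k <= q - p -> val (iter k (@ordS n.+1) p) = p + k.
  move=> kqp; rewrite val_iter_ordS modn_small //.
  by apply: leq_ltn_trans (ltn_ord q); rewrite -leq_subRL.
have iterE : iter (q - p) (@ordS n.+1) p = q.
  by apply: val_inj; rewrite valE ?subnKC.
have qpn : q - p < n.+1 by apply: leq_ltn_trans (leq_subr _ _) _.
have -> : iota 0 n.+1 = iota 0 (q - p) ++ iota (q - p) (n.+1 - (q - p)).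
  by rewrite -{2}[q - p]add0n -iotaD subnKC // ltnW.
rewrite find_cat ifN; last first.
  apply/hasPn=> k; rewrite mem_iota add0n /= => k_lt; rewrite /a negbK.
  by apply: occ; rewrite valE ?(ltnW k_lt) ?leq_addr // -ltn_subRL.
rewrite size_iota -(ltn_predK (_ : 0 < n.+1 - (q - p))) ?subn_gt0 //=.
by rewrite /a iterE qO addn0.
Qed.

(** The search is defined from [ordS] and membership only, and the rotation
    preserves both. *)
Lemma circ_space_rot O p :
  circ_space (@ordS n.+1 @: O) (ordS p) = ordS (circ_space O p).
Proof.
rewrite /circ_space -iterS iterSr; congr (iter _ _ _).
by apply: eq_find => k; rewrite -iterSr iterS mem_imset //; apply: ordS_inj.
Qed.

Definition circ_stage f k : {set 'I_n.+1} :=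
  foldl (fun O i => circ_space O (f i) |: O) set0 (take k (enum 'I_n)).

Lemma circ_stage0 f : circ_stage f 0 = set0.
Proof. by rewrite /circ_stage take0. Qed.

Lemma circ_stageS f (i : 'I_n) :
  circ_stage f i.+1 = circ_space (circ_stage f i) (f i) |: circ_stage f i.
Proof. by rewrite /circ_stage take_enum_ordS foldl_rcons. Qed.

(** At most [n] of the [n.+1] spaces are occupied, so each arriving car finds a
    new one. *)
Lemma card_circ_stage f k : k <= n -> #|circ_stage f k| = k.
Proof.
elim: k => [|k IHk] kn; first by rewrite circ_stage0 cards0.
rewrite (circ_stageS f (Ordinal kn)) cardsU1 IHk ?(ltnW kn) //.
rewrite circ_space_free //; apply: contraTneq (kn) => fullT.
by have := IHk (ltnW kn); rewrite fullT cardsT card_ord => <-;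
   rewrite -leqNgt leqnSn.
Qed.

Lemma circ_stage_rot f k :
  circ_stage [ffun i => ordS (f i)] k = @ordS n.+1 @: circ_stage f k.
Proof.
rewrite /circ_stage; elim/last_ind: (take k _) => [|r i IH] /=.
  by rewrite imset0.
by rewrite !foldl_rcons IH ffunE circ_space_rot imsetU1.
Qed.

Lemma circ_stage_mono f k m :
  k <= m <= n -> circ_stage f k \subset circ_stage f m.
Proof.
elim: m => [|m IHm]; first by rewrite leqn0 => /andP[/eqP->].
case/andP; rewrite leq_eqVlt => /predU1P[->//|km mn].
rewrite (circ_stageS f (Ordinal mn)); apply: subset_trans (subsetU1 _ _).
by apply: IHm; rewrite -ltnS km ltnW.
Qed.

Definition leaves_free q : {set {ffun 'I_n -> 'I_n.+1}} :=
  [set f | q \notin circ_stage f n].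

Lemma card_leaves_freeS q : #|leaves_free (ordS q)| = #|leaves_free q|.
Proof.
pose rot f : {ffun 'I_n -> 'I_n.+1} := [ffun i => ordS (f i)].
have rot_inj : injective rot.
  by move=> f g /ffunP eq_fg; apply/ffunP=> i; have := eq_fg i;
     rewrite !ffunE; apply: ordS_inj.
rewrite -[RHS](card_imset _ rot_inj); apply: eq_card => f.
pose g : {ffun 'I_n -> 'I_n.+1} := [ffun i => ord_pred (f i)].
have -> : f = rot g by apply/ffunP=> i; rewrite !ffunE ord_predK.
rewrite (mem_imset _ _ rot_inj) !inE circ_stage_rot mem_imset //.
exact: ordS_inj.
Qed.

(** By rotation the sets [leaves_free q] all have the same size. They partition
    the preference functions, as each one leaves a single space free. *)
Lemma card_leaves_free q : #|leaves_free q| * n.+1 = n.+1 ^ n.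
Proof.
have const p : #|leaves_free p| = #|leaves_free q|.
  have [k _ <-] := iter_ordS_reach q p.
  by elim: k => //= k; rewrite card_leaves_freeS.
rewrite mulnC -{1}[n.+1]card_ord -sum_nat_const.
rewrite -(eq_bigr _ (fun p _ => const p)).
under eq_bigr do rewrite -sum1_card big_mkcond.
have <- : #|{: {ffun 'I_n -> 'I_n.+1}}| = n.+1 ^ n.
  by rewrite card_ffun !card_ord.
(* Double counting of the pairs of a preference function and its free space. *)
rewrite exchange_big -sum1_card.
apply: eq_bigr => f _; rewrite -big_mkcond sum1_card /=.
transitivity #|~: circ_stage f n|.
  by apply: eq_card => p; rewrite -[LHS]/(f \in leaves_free p) !inE.
apply/eqP; rewrite -(eqn_add2l #|circ_stage f n|) cardsC card_circ_stage //.
by rewrite card_ord addn1.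
Qed.

End Circle.

(** * Parking functions on the circle *)

Section Link.
Variable n : nat.
Implicit Types (st : street n) (pi : {ffun 'I_n -> 'I_n}).

Definition to_circle (s : 'I_n) : 'I_n.+1 := widen_ord (leqnSn n) s.

Lemma to_circle_inj : injective to_circle.
Proof. by move=> s t [] /val_inj. Qed.

Definition circle_prefs pi : {ffun 'I_n -> 'I_n.+1} :=
  [ffun i => to_circle (pi i)].

Definition occupied st : {set 'I_n.+1} := to_circle @: [set s | isSome (st s)].

Lemma mem_occupied st s : (to_circle s \in occupied st) = st s.
Proof. by rewrite mem_imset ?inE //; apply: to_circle_inj. Qed.

Lemma ord_max_free st : ord_max \notin occupied st.
Proof.
by apply/imsetP=> -[s _ [nE]]; have := ltn_ord s; rewrite -nE ltnn.
Qed.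

Lemma to_circleP (q : 'I_n.+1) : q < n -> exists s, q = to_circle s.
Proof. by move=> qn; exists (Ordinal qn); apply: val_inj. Qed.

(** The added space [ord_max] is the first one after the end of the street: as
    long as it is free, it stops precisely the cars that would exit. *)
Lemma circ_space_occupied st p :
  circ_space (occupied st) (to_circle p) =
  oapp to_circle ord_max (parking_space st p).
Proof.
case: parking_spaceP => [s st_s ps occ | occ] /=.
  apply: circ_space_first => //; first by rewrite mem_occupied st_s.
  move=> t pt ts; have [u tE] := to_circleP (leq_trans ts (ltnW (ltn_ord s))).
  by rewrite tE mem_occupied occ //; rewrite tE in pt ts.
apply: circ_space_first; first exact: ord_max_free.
  exact/ltnW/(ltn_ord p).
move=> t pt ts; have [u tE] := to_circleP ts.
by rewrite tE mem_occupied occ //; rewrite tE in pt.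
Qed.

Lemma occupied_stage pi k : k <= n ->
    (forall i : 'I_n, i < k -> parking_space (stage pi i) (pi i)) ->
  circ_stage (circle_prefs pi) k = occupied (stage pi k).
Proof.
elim: k => [_ _|k IHk kn park].
  by rewrite circ_stage0 stage0; apply/esym/eqP; rewrite imset_eq0 -subset0;
     apply/subsetP=> s; rewrite inE ffunE.
pose i := Ordinal kn.
rewrite (circ_stageS _ i) (stageS _ i) /= IHk ?(ltnW kn) //; last first.
  by move=> j jk; apply: park; apply: ltnW.
rewrite ffunE circ_space_occupied /park_car.
case: (parking_space _ _) (park i (ltnSn k)) => [s /= _|//].
rewrite /occupied -imsetU1; congr (_ @: mem (pred_of_set _)); apply/setP=> t.
by rewrite !inE ffunE; case: eqP.
Qed.

(** Street and circle agree up to the first car that exits the street; that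
    car takes the added space on the circle, which stays occupied. *)
Lemma is_parking_function_circle pi :
  is_parking_function pi = (circle_prefs pi \in leaves_free ord_max).
Proof.
rewrite inE; apply/is_parking_functionP/idP => [park | max_free i].
  by rewrite occupied_stage ?ord_max_free.
have all_park k : k <= n ->
    forall i : 'I_n, i < k -> parking_space (stage pi i) (pi i).
  elim: k => // k IHk kn j; rewrite ltnS leq_eqVlt => /predU1P[jk|]; last first.
    by apply: IHk; apply: ltnW.
  have /subsetP sub : circ_stage (circle_prefs pi) k.+1 \subset
      circ_stage (circle_prefs pi) n.
    by apply: circ_stage_mono; rewrite kn leqnn.
  have := contra (sub ord_max) max_free.
  rewrite -jk circ_stageS occupied_stage //; last first.
  - by rewrite jk; apply: IHk; apply: ltnW.
  - exact: ltnW.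
  rewrite ffunE circ_space_occupied.
  by case: (parking_space _ _) => //=; rewrite inE set11.
exact: (all_park n).
Qed.

(** A car that prefers the added space finds it free, and takes it, or finds it
    already taken. *)
Lemma leaves_free_max_avoid f i : f \in leaves_free (@ord_max n) -> f i < n.
Proof.
rewrite inE; apply: contraR; rewrite -leqNgt => n_fi.
have fiE : f i = ord_max by apply/val_inj/anti_leq; rewrite -ltnS ltn_ord.
have sub k : k <= n -> circ_stage f k \subset circ_stage f n.
  by move=> kn; apply: circ_stage_mono; rewrite kn /=.
have [|free_i] := boolP (ord_max \in circ_stage f i).
  exact/subsetP/sub/ltnW.
apply: (subsetP (sub _ (ltn_ord i))); rewrite circ_stageS fiE.
rewrite (circ_space_first free_i) ?set11 //; first by rewrite inE set11.
by move=> t; rewrite leqNgt => /negPf->.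
Qed.

Lemma card_parking_function : #|{: parking_function n}| = n.+1 ^ n.-1.
Proof.
have pref_inj : injective circle_prefs.
  move=> pi pi' /ffunP eq_pi; apply/ffunP=> i.
  by have := eq_pi i; rewrite !ffunE => /to_circle_inj.
have cardE : #|{: parking_function n}| = #|leaves_free (@ord_max n)|.
  rewrite card_sig -(card_imset _ pref_inj); apply: eq_card => f.
  apply/imsetP/idP => [[pi pi_park ->] | f_free].
    by rewrite -is_parking_function_circle.
  pose pi := [ffun i => Ordinal (leaves_free_max_avoid i f_free)].
  have fE : f = circle_prefs pi.
    by apply/ffunP=> i; rewrite !ffunE; apply: val_inj.
  by exists pi; rewrite // inE is_parking_function_circle -fE.
have := card_leaves_free (@ord_max n); rewrite -cardE.
case: (n) (#|_|) => [|m] c; first by rewrite muln1.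
by rewrite expnSr => /eqP; rewrite eqn_pmul2r // => /eqP.
Qed.

End Link.

Theorem theorem1 (n : nat) (sigma : 'S_n) :
  park_prob sigma = ((run_length_prod sigma)%:R / n.+1%:R ^+ n.-1)%R.
Proof.
by rewrite /park_prob card_outcome_fibre card_parking_function GRing.natrX.
Qed.
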